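(* Let $0<a_{\mathbf K}<c_{\mathbf K}$ and let the reflection wall be the branch $\mathcal B_F$ (enclosing $F$) of the hyperbola with foci $F=(-2c_{\mathbf K},0)$, $F'=(0,0)$ and semi-major axis $a_{\mathbf K}$. A pair $(a,R)$ with $a>0$, $R\ge 0$ is admissible for $\mathcal B_F$ if and only if one of the following holds: $$\frac{c_{\mathbf K}-a_{\mathbf K}}{2}\le a\le c_{\mathbf K}\quad\text{and}\quad 2(c_{\mathbf K}-a)\le R\le 2(a+a_{\mathbf K}),$$ or $$a>c_{\mathbf K}\quad\text{and}\quad 0\le R\le 2(a+a_{\mathbf K}).$$
   Context: $\mathcal B_F$ is the set of points $(x,y)$ with $\frac{(x+c_{\mathbf K})^2}{a_{\mathbf K}^2}-\frac{y^2}{c_{\mathbf K}^2-a_{\mathbf K}^2}=1$ and $x<-c_{\mathbf K}+a_{\mathbf K}$, i.e. the branch around $F$, whose points satisfy $|F'P|-|FP|=2a_{\mathbf K}$. A Kepler orbit with center of force $F$, semi-major axis $a$ and second focus $F_1$ is the (possibly degenerate) ellipse $\{X:|FX|+|XF_1|=2a\}$ with $|FF_1|\le 2a$; when $|FF_1|=2a$ it degenerates to the segment $FF_1$. In the Kepler billiard reflected at $\mathcal B_F$, all orbital second foci lie on the circle $S(F',R)$ of radius $R$ centered at $F'$ (for $R=0$ the point $F'$). The pair $(a,R)$ is called admissible for $\mathcal B_F$ if there is a point $F_1$ on $S(F',R)$ such that the associated (possibly degenerate) Kepler ellipse with foci $F,F_1$ and semi-major axis $a$ intersects $\mathcal B_F$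 in at least one point. *)

(* Defs.v *)
From Stdlib Require Import Reals.
Open Scope R_scope.

Definition point : Type := (R * R)%type.

Definition distance (P Q : point) : R :=
  dist_euc (fst P) (snd P) (fst Q) (snd Q).

(* The foci F and F' of the hyperbola: F is the center of force. *)
Definition focus_F (cK : R) : point := (- 2 * cK, 0).
Definition focus_F' : point := (0, 0).

(* On the hyperbola |x + cK| >= aK, so the strict inequality excludes exactly
   the branch around F', whose vertex has abscissa - cK + aK. *)
Definition branch_F (aK cK : R) (P : point) : Prop :=
  (fst P + cK) ^ 2 / aK ^ 2 - snd P ^ 2 / (cK ^ 2 - aK ^ 2) = 1 /\
  fst P < - cK + aK.

Definition circle (center : point) (radius : R) (P : point) : Prop :=
  distance center P = radius.

(* The orbit with foci F and F1 and semi-major axis a; it is a Kepler ellipse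
   when |F F1| <= 2 a, and the segment [F F1] when |F F1| = 2 a. *)
Definition ellipse (F F1 : point) (a : R) (X : point) : Prop :=
  distance F X + distance X F1 = 2 * a.

Definition admissible (aK cK a radius : R) : Prop :=
  exists F1 : point,
    circle focus_F' radius F1 /\
    distance (focus_F cK) F1 <= 2 * a /\
    exists X : point, ellipse (focus_F cK) F1 a X /\ branch_F aK cK X.

(* Main.v *)
Require Import Defs.
From Stdlib Require Import Reals Lra.
Open Scope R_scope.

(** A point [X] of the branch satisfies [|F'X| = |FX| + 2 aK] and
    [|FX| >= cK - aK], so the bounds on [a] and [radius] follow from the
    triangle inequality.  Conversely, take [X] on the branch with
    [|FX| = a - aK + radius / 2] and [F1] on the segment [F'X] with
    [|F'F1| = radius]; then [|XF1| = |F'X| - radius = 2 a - |FX|]. *)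

Lemma dist_euc_eq (x0 y0 x1 y1 d : R) :
  0 <= d -> (x0 - x1) ^ 2 + (y0 - y1) ^ 2 = d ^ 2 -> dist_euc x0 y0 x1 y1 = d.
Proof.
  intros hd h. unfold dist_euc. rewrite !Rsqr_pow2, h.
  now apply sqrt_pow2.
Qed.

Lemma distance_triangle (P Q S : point) :
  distance P Q <= distance P S + distance S Q.
Proof. apply triangle. Qed.

Lemma distance_sym (P Q : point) : distance P Q = distance Q P.
Proof. apply distance_symm. Qed.

Lemma distance_ge0 (P Q : point) : 0 <= distance P Q.
Proof. apply sqrt_pos. Qed.

Lemma distance_foci (cK : R) :
  0 <= cK -> distance (focus_F cK) focus_F' = 2 * cK.
Proof. intros hc. apply dist_euc_eq; simpl; [lra | ring]. Qed.

(** Here [t] plays the role of cosh in the hyperbolic parametrization. Fixing only the square of the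
    ordinate covers the upper and lower halves of the branch at once. *)
Lemma branch_F_param (aK cK : R) (haK : 0 < aK) (hcK : aK < cK) (P : point) :
  branch_F aK cK P <->
  exists t : R, 1 <= t /\ fst P = - cK - aK * t /\
    snd P ^ 2 = (cK ^ 2 - aK ^ 2) * (t ^ 2 - 1).
Proof.
  assert (hb : 0 < cK ^ 2 - aK ^ 2) by nra.
  destruct P as [x y]; unfold branch_F; simpl fst; simpl snd; split.
  - intros [heq hlt].
    exists (- (x + cK) / aK).
    assert (hx : x = - cK - aK * (- (x + cK) / aK)) by (field; lra).
    assert (hy : y ^ 2 = (cK ^ 2 - aK ^ 2) * ((- (x + cK) / aK) ^ 2 - 1)).
    { replace ((- (x + cK) / aK) ^ 2) with ((x + cK) ^ 2 / aK ^ 2)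
        by (field; lra).
      replace ((x + cK) ^ 2 / aK ^ 2 - 1) with (y ^ 2 / (cK ^ 2 - aK ^ 2))
        by lra.
      field; lra. }
    set (t := - (x + cK) / aK) in *.
    repeat split; [| exact hx | exact hy].
    (* The strict bound on [x] gives [-1 < t], and [hy] gives [1 <= t ^ 2]; together they discard
       the branch around F', where [t <= -1]. *)
    assert (ht : -1 < t) by nra.
    assert (0 <= t ^ 2 - 1).
    { apply Rmult_le_reg_l with (cK ^ 2 - aK ^ 2); [exact hb |].
      rewrite <- hy, Rmult_0_r. apply pow2_ge_0. }
    nra.
  - intros [t [ht [-> ->]]]. split; [field; split; lra | nra].
Qed.

(** After substitution the squared distance is the perfect square [(cK * t - aK) ^ 2]; for the other
    focus it is [(cK * t + aK) ^ 2]. *)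
Lemma distance_param_F (aK cK t : R) (P : point) :
  0 < aK -> aK < cK -> 1 <= t -> fst P = - cK - aK * t ->
  snd P ^ 2 = (cK ^ 2 - aK ^ 2) * (t ^ 2 - 1) ->
  distance (focus_F cK) P = cK * t - aK.
Proof.
  intros ha hc ht hx hy. apply dist_euc_eq; [nra |]; simpl fst; simpl snd.
  replace ((0 - snd P) ^ 2) with (snd P ^ 2) by ring. rewrite hx, hy. ring.
Qed.

Lemma distance_param_F' (aK cK t : R) (P : point) :
  0 < aK -> aK < cK -> 1 <= t -> fst P = - cK - aK * t ->
  snd P ^ 2 = (cK ^ 2 - aK ^ 2) * (t ^ 2 - 1) ->
  distance focus_F' P = cK * t + aK.
Proof.
  intros ha hc ht hx hy. apply dist_euc_eq; [nra |]; simpl fst; simpl snd.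
  replace ((0 - snd P) ^ 2) with (snd P ^ 2) by ring. rewrite hx, hy. ring.
Qed.

Lemma branch_F_distances (aK cK : R) (haK : 0 < aK) (hcK : aK < cK) (P : point) :
  branch_F aK cK P ->
  cK - aK <= distance (focus_F cK) P /\
  distance focus_F' P = distance (focus_F cK) P + 2 * aK.
Proof.
  intros hP. apply branch_F_param in hP as [t [ht [hx hy]]]; try assumption.
  rewrite (distance_param_F aK cK t), (distance_param_F' aK cK t) by assumption.
  split; nra.
Qed.

(** The focal distance [cK * t - aK] is affine in [t], so it can be solved for [t]; the bound on [r]
    amounts to [1 <= t]. *)
Lemma branch_F_at_distance (aK cK r : R) (haK : 0 < aK) (hcK : aK < cK) :
  cK - aK <= r ->
  exists P : point, branch_F aK cK P /\ distance (focus_F cK) P = r.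
Proof.
  intros hr. set (t := (r + aK) / cK).
  assert (hct : cK * t = r + aK) by (unfold t; field; lra).
  assert (ht : 1 <= t) by nra.
  set (y := sqrt ((cK ^ 2 - aK ^ 2) * (t ^ 2 - 1))).
  assert (hy : y ^ 2 = (cK ^ 2 - aK ^ 2) * (t ^ 2 - 1)).
  { apply pow2_sqrt. apply Rmult_le_pos; nra. }
  exists (- cK - aK * t, y). split.
  - apply branch_F_param; try assumption. now exists t.
  - rewrite (distance_param_F aK cK t) by (assumption || reflexivity). lra.
Qed.

(** Since F' is the origin, scaling [P] by [s / d], with [d] its norm, gives the point. *)
Lemma point_on_segment (P : point) (s : R) :
  0 <= s <= distance focus_F' P -> 0 < distance focus_F' P ->
  exists Q : point, distance focus_F' Q = s /\
    distance P Q = distance focus_F' P - s.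
Proof.
  destruct P as [x y]. set (d := distance focus_F' (x, y)). intros hs hd.
  assert (hd2 : x ^ 2 + y ^ 2 = d ^ 2).
  { unfold d, distance, dist_euc; simpl fst; simpl snd.
    rewrite pow2_sqrt, !Rsqr_pow2; [ring |].
    apply Rplus_le_le_0_compat; apply Rle_0_sqr. }
  exists (s / d * x, s / d * y).
  split; apply dist_euc_eq; simpl fst; simpl snd; try lra.
  - replace ((0 - s / d * x) ^ 2 + (0 - s / d * y) ^ 2)
      with ((s / d) ^ 2 * (x ^ 2 + y ^ 2)) by ring.
    rewrite hd2. field. lra.
  - replace ((x - s / d * x) ^ 2 + (y - s / d * y) ^ 2)
      with ((1 - s / d) ^ 2 * (x ^ 2 + y ^ 2)) by ring.
    rewrite hd2. field. lra.
Qed.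

Theorem proposition2p1 (aK cK : R) (haK : 0 < aK) (hcK : aK < cK)
    (a radius : R) (ha : 0 < a) (hradius : 0 <= radius) :
  admissible aK cK a radius <->
  ((cK - aK) / 2 <= a <= cK /\ 2 * (cK - a) <= radius <= 2 * (a + aK)) \/
  (a > cK /\ 0 <= radius <= 2 * (a + aK)).
Proof.
  split.
  - intros [F1 [hF1 [hFF1 [X [hell hX]]]]].
    unfold circle in hF1; unfold ellipse in hell.
    destruct (branch_F_distances aK cK haK hcK X hX) as [hmin hdiff].
    pose proof (distance_triangle focus_F' F1 X).
    pose proof (distance_triangle (focus_F cK) focus_F' F1) as hfoci.
    rewrite distance_foci, (distance_sym F1) in hfoci by lra.
    pose proof (distance_ge0 X F1).
    (* The triangle F' X F1 bounds [radius] above, the triangle F F1 F' bounds it below, and [hmin]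
       with [|XF1| >= 0] bounds [a] below. *)
    destruct (Rle_or_lt a cK); [left | right]; lra.
  - intros hcases.
    destruct (branch_F_at_distance aK cK (a - aK + radius / 2) haK hcK)
      (* The distance is large enough when [cK <= a + radius / 2], which holds in both cases. *)
      as [X [hX hFX]]; [lra |].
    destruct (branch_F_distances aK cK haK hcK X hX) as [_ hF'X].
    (* As [|F'X| = a + aK + radius / 2], the requirement [radius <= |F'X|] is exactly
       [radius <= 2 * (a + aK)]. *)
    destruct (point_on_segment X radius) as [F1 [hF1 hXF1]]; try lra.
    exists F1. repeat split.
    + exact hF1.
    + pose proof (distance_triangle (focus_F cK) F1 X). lra.
    + exists X. split; [unfold ellipse; lra | exact hX].
Qed.
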